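(* Let $G$ be a group of order $n$, written additively, and let $\mathcal{S}'=\{D_1,\ldots,D_m\}$ be a collection of pairwise disjoint $k$-subsets of $G$ such that each $D_i$ is an $(n,k,\lambda,\mu)$-partial difference set. Let $S=\bigcup_{i=1}^m D_i$. Then (i) $\mathcal{S}'$ is an $(n,m,k,\lambda+(m-1)\mu,m\mu)$-disjoint partial difference family; (ii) if $S$ is an $(n,mk,\sigma,\chi)$-partial difference set, then $\mathcal{S}'$ is an $(n,m,k,\sigma-(\lambda+(m-1)\mu),\chi-m\mu)$-external partial difference family; and if $S$ is an $(n,mk,\sigma)$-difference set, then $\mathcal{S}'$ is an $(n,m,k,\sigma-(\lambda+(m-1)\mu),\sigma-m\mu)$-external partial difference family.
   Context: $G^*=G\setminus\{0\}$. For $D\subseteq G$, $\Delta(D)$ is the multiset $\{x-y: x,y\in D,\ x\neq y\}$; for disjoint $D_1,D_2$, $\Delta(D_1,D_2)$ is the multiset $\{x-y:x\in D_1,y\in D_2\}$; $\lambda A$ is the multiset with $\lambda$ copies of each element of $A$. A $k$-subset $D$ is an $(n,k,\lambda)$-difference set if $\Delta(D)=\lambda G^*$, and an $(n,k,\lambda,\mu)$-partial difference set if $\Delta(D)=\lambda D+\mu(G^*\setminus D)$. For a collection $\{D_1,\dots,D_m\}$ of disjoint $k$-subsets with $S=\bigcup_i D_i$: it is an $(n,m,k,\lambda,\mu)$-disjoint partial difference family if $\bigcup_{i}\Delta(D_i)=\lambda S+\mu(G^*\setminus S)$, and an $(n,m,k,\lambda,\mu)$-external partial difference family if $\bigcup_{i\neq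 j}\Delta(D_i,D_j)=\lambda S+\mu(G^*\setminus S)$.
   Formalization: The last clause of (ii) (S a difference set) is stated with the extra hypothesis that 0 is not in S; without it the clause fails, e.g. in Z_7 with D_i = {0}, {1}, {3} and S = {0,1,3}, where λS contains 0 but no external difference is 0. *)

(* Defs.v *)
From HB Require Import structures.
From mathcomp Require Import all_boot all_fingroup.

Set Implicit Arguments.
Unset Strict Implicit.
Unset Printing Implicit Defensive.

Import GroupScope.

(* The group is not assumed abelian, so it is a finGroupType, whose law is     *)
(* multiplicative: 0 is 1, x - y is x * y^-1, and G^* is [set: gT]^#.          *)
(* Multisets are sequences, up to perm_eq; their sum is concatenation.         *)

Definition copies (gT : finGroupType) (l : nat) (A : {set gT}) : seq gT :=
  \big[cat/[::]]_(x in A) nseq l x.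

Definition Delta (gT : finGroupType) (D : {set gT}) : seq gT :=
  [seq x * y^-1 | x <- enum D, y <- [seq y <- enum D | x != y]].

Definition Delta2 (gT : finGroupType) (D1 D2 : {set gT}) : seq gT :=
  [seq x * y^-1 | x <- enum D1, y <- enum D2].

Definition partial_mset (gT : finGroupType) (l u : nat) (A : {set gT}) :
    seq gT :=
  copies l A ++ copies u ([set: gT]^# :\: A).

Definition is_difference_set (gT : finGroupType) (n k l : nat) (D : {set gT}) :
    Prop :=
  [/\ #|[set: gT]| = n, #|D| = k & perm_eq (Delta D) (copies l [set: gT]^#)].

Definition is_partial_difference_set (gT : finGroupType) (n k l u : nat)
    (D : {set gT}) : Prop :=
  [/\ #|[set: gT]| = n, #|D| = k & perm_eq (Delta D) (partial_mset l u D)].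

Definition disjoint_ksubsets (gT : finGroupType) (m k : nat)
    (D : 'I_m -> {set gT}) : Prop :=
  (forall i, #|D i| = k) /\ (forall i j, i != j -> [disjoint D i & D j]).

Definition is_DPDF (gT : finGroupType) (n m k l u : nat)
    (D : 'I_m -> {set gT}) : Prop :=
  [/\ #|[set: gT]| = n, disjoint_ksubsets k D &
      perm_eq (\big[cat/[::]]_(i < m) Delta (D i))
              (partial_mset l u (\bigcup_(i < m) D i))].

Definition is_EPDF (gT : finGroupType) (n m k l u : nat)
    (D : 'I_m -> {set gT}) : Prop :=
  [/\ #|[set: gT]| = n, disjoint_ksubsets k D &
      perm_eq (\big[cat/[::]]_(i < m) \big[cat/[::]]_(j < m | i != j)
                 Delta2 (D i) (D j))
              (partial_mset l u (\bigcup_(i < m) D i))].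

(* Main.v *)
Require Import Defs.
From HB Require Import structures.
From mathcomp Require Import all_boot all_fingroup.

Set Implicit Arguments.
Unset Strict Implicit.
Unset Printing Implicit Defensive.

Import GroupScope.

(** All the multisets are compared through the multiplicity of each [z].
    If [z] lies in [D i], it is represented [lambda] times in [Delta (D i)] and
    [mu] times in each of the other [m - 1] multisets; if [z] is outside [S], it
    is represented [mu] times in each. The external differences are what
    remains of [Delta S] once the internal ones are removed.

    The delicate point is [z = 1], which never occurs as a difference but may
    belong to some [D i]. Then [lambda = 0], and since [x = x * 1^-1] is a
    difference for every other [x] in [D i], [D i] is [[set 1]]; this forces
    [mu = 0] or [gT] trivial, and in the latter case [m = 1]. *)

Section Multiplicities.

Variable gT : finGroupType.
Implicit Types (A B D : {set gT}) (z : gT) (l u : nat).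

Lemma count_bigcat (I T : Type) (a : pred T) (r : seq I) (P : pred I)
    (F : I -> seq T) :
  count a (\big[cat/[::]]_(i <- r | P i) F i)
    = (\sum_(i <- r | P i) count a (F i))%N.
Proof. by apply: (big_morph (count a)) => // s t; rewrite count_cat. Qed.

Lemma count_copies z l A : count_mem z (copies l A) = if z \in A then l else 0%N.
Proof.
rewrite count_bigcat.
under eq_bigr => x _ do rewrite count_nseq /=.
case: ifP => zA.
  by rewrite (bigD1 z) //= eqxx mul1n big1 ?addn0 // => x /andP[_ /negPf ->].
by apply: big1 => x xA; case: eqP => // xz; rewrite -xz xA in zA.
Qed.

Lemma count_partial_mset z l u A :
  count_mem z (partial_mset l u A)
    = if z \in A then l else if z == 1 then 0%N else u.
Proof.
by rewrite count_cat !count_copies !inE; case: (z \in A); case: (z == 1);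
   rewrite ?addn0.
Qed.

(** The test [x != y] is kept even for pairs from two disjoint sets, where it is automatic, so that
    internal and external differences are sums of one and the same term. *)
Definition ndiff z x y : nat := (x != y) && (x * y^-1 == z).

Lemma count_enum_sum (P : pred gT) A : count P (enum A) = (\sum_(x in A) P x)%N.
Proof. by rewrite -sum1_count big_mkcond big_enum. Qed.

Lemma count_Delta z D :
  count_mem z (Delta D) = (\sum_(x in D) \sum_(y in D) ndiff z x y)%N.
Proof.
rewrite count_flatten sumnE !big_map big_enum /=; apply: eq_bigr => x _.
rewrite count_map count_filter count_enum_sum; apply: eq_bigr => y _ /=.
by rewrite /ndiff andbC.
Qed.

Lemma count_Delta2 z A B : [disjoint A & B] ->
  count_mem z (Delta2 A B) = (\sum_(x in A) \sum_(y in B) ndiff z x y)%N.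
Proof.
move=> dAB; rewrite count_flatten sumnE !big_map big_enum /=.
apply: eq_bigr => x xA; rewrite count_map count_enum_sum.
apply: eq_bigr => y yB; rewrite /ndiff /=.
by have [xy|//] := eqVneq x y; rewrite -xy (disjointFr dAB xA) in yB.
Qed.

Lemma count_Delta1 D : count_mem 1 (Delta D) = 0%N.
Proof.
rewrite count_Delta big1 // => x _; rewrite big1 // => y _.
by rewrite /ndiff -eq_mulgV1 andNb.
Qed.

(** Each ordered pair of points of the union is sorted by the blocks [D i] and [D j] that contain
    them; the pairs with [i = j] are the internal ones. *)
Lemma count_Delta_bigcup m (D : 'I_m -> {set gT}) z :
    (forall i j, i != j -> [disjoint D i & D j]) ->
  count_mem z (Delta (\bigcup_(i < m) D i))
    = (count_mem z (\big[cat/[::]]_(i < m) \big[cat/[::]]_(j < m | i != j)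
                      Delta2 (D i) (D j))
       + count_mem z (\big[cat/[::]]_(i < m) Delta (D i)))%N.
Proof.
move=> dD; rewrite !count_bigcat -big_split count_Delta.
rewrite partition_disjoint_bigcup //; apply: eq_bigr => i _.
under eq_bigr => x _ do rewrite partition_disjoint_bigcup //.
(* With the block of [y] as outer index, the term [j = i] that splits off is the count in
   [Delta (D i)]. *)
rewrite exchange_big (bigD1 i) //= addnC count_bigcat count_Delta.
congr (_ + _)%N; under eq_bigl => j do rewrite eq_sym.
by apply: eq_bigr => j ij; rewrite count_Delta2 // dD.
Qed.

Section PartialDifferenceSet.

Variables (n k l u : nat) (D : {set gT}).
Hypothesis pdsD : is_partial_difference_set n k l u D.

Lemma count_Delta_pds z :
  count_mem z (Delta D) = if z \in D then l else if z == 1 then 0%N else u.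
Proof. by case: pdsD => _ _ /seq.permP ->; rewrite count_partial_mset. Qed.

Lemma pds1_lambda0 : 1 \in D -> l = 0%N.
Proof. by move=> D1; have := count_Delta_pds 1; rewrite D1 count_Delta1. Qed.

Lemma pds1_set1 : 1 \in D -> D = [set 1].
Proof.
move=> D1; apply/setP => x; rewrite inE; apply/idP/eqP => [xD|-> //].
have := count_Delta_pds x; rewrite xD (pds1_lambda0 D1) count_Delta => /eqP.
rewrite sum_nat_eq0 => /forall_inP/(_ x xD).
rewrite sum_nat_eq0 => /forall_inP/(_ 1 D1).
by rewrite /ndiff invg1 mulg1 eqxx andbT eqb0 negbK => /eqP.
Qed.

(** A singleton has no differences, yet [z], lying outside [[set 1]], must occur [u] times. *)
Lemma pds1_mu0 z : 1 \in D -> z != 1 -> u = 0%N.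
Proof.
move=> D1 z1; have := count_Delta_pds z; rewrite (pds1_set1 D1) inE (negPf z1).
rewrite count_Delta big_set1 big_set1 /ndiff.
by rewrite eqxx.
Qed.

End PartialDifferenceSet.

Section DisjointFamily.

Variables (n m k lambda mu : nat) (D : 'I_m -> {set gT}).
Hypothesis hD : disjoint_ksubsets k D.
Hypothesis hpds : forall i, is_partial_difference_set n k lambda mu (D i).

Let S := \bigcup_(i < m) D i.

(** Serves at [z = 1], where the multiplicity [lambda + (m - 1) * mu] of the points of [S] has to
    vanish. *)
Lemma family1_mu0 : 1 \in S -> ((m - 1) * mu = 0)%N.
Proof.
case/bigcupP => i _ Di1; have [/eqP ->|] := boolP (m <= 1)%N; first by [].
rewrite -ltnNge => m_gt1.
have [j ij] : exists j, i != j.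
  apply/existsP; apply: contraTT m_gt1 => /existsPn all_i.
  rewrite -leqNgt -(card_ord m); apply/card_le1_eqP => x y _ _.
  by have/negPn/eqP <- := all_i x; have/negPn/eqP <- := all_i y.
case: hD => cD dD.
(* All blocks have the size of [D i], which is [[set 1]]; so [D j] has a point, and by disjointness
   it is not [1]. *)
have /card_gt0P[z zDj] : (0 < #|D j|)%N.
  by rewrite cD -(cD i) (pds1_set1 (hpds i)) // cards1.
have z1 : z != 1.
  by apply: contraTneq zDj => ->; rewrite (disjointFr (dD _ _ ij) Di1).
by rewrite (pds1_mu0 (hpds i) Di1 z1) muln0.
Qed.

Lemma count_internal z :
  count_mem z (\big[cat/[::]]_(i < m) Delta (D i))
    = count_mem z (partial_mset (lambda + (m - 1) * mu) (m * mu) S).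
Proof.
rewrite count_bigcat count_partial_mset.
have [->|z1] := eqVneq z 1.
  rewrite big1 => [|i _]; last exact: count_Delta1.
  case: ifP => // S1; rewrite family1_mu0 // addn0.
  by case/bigcupP: S1 => i _ /(pds1_lambda0 (hpds i)).
under eq_bigr => i _ do rewrite (count_Delta_pds (hpds i)) (negPf z1).
case: ifP => [/bigcupP[i _ zDi]|/bigcupP zNS].
  rewrite (bigD1 i) //= zDi; congr addn.
  rewrite (eq_bigr (fun=> mu)) => [|j ji]; last first.
    by rewrite (disjointFl (hD.2 _ _ ji) zDi).
  by rewrite sum_nat_const cardC1 card_ord subn1.
rewrite (eq_bigr (fun=> mu)) ?sum_nat_const ?card_ord // => i _.
by case: ifP => // zDi; case: zNS; exists i.
Qed.

(** Only the multiset identity is assumed of [S], so that both kinds of difference set can supply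
    it. *)
Lemma family_EPDF (sigma chi : nat) :
    #|[set: gT]| = n ->
    perm_eq (Delta S) (partial_mset sigma chi S) ->
  is_EPDF n k (sigma - (lambda + (m - 1) * mu)) (chi - m * mu) D.
Proof.
move=> hn /seq.permP pS; split=> //; apply/allP => z _ /=; apply/eqP.
have := count_Delta_bigcup z hD.2; rewrite pS count_internal.
(* The internal count is a summand of the total, so the truncated subtraction is exact here. *)
move=> /esym/(canRL (addnK _)) ->; rewrite !count_partial_mset.
by case: ifP => // _; case: ifP.
Qed.

End DisjointFamily.

(** The nonidentity elements split into [A] and the rest only when [1] is not in [A]; otherwise the
    right side would also hold [l] copies of [1]. *)
Lemma copies_partial_mset l A : 1 \notin A ->
  perm_eq (copies l [set: gT]^#) (partial_mset l l A).
Proof.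
move=> A1; apply/allP => z _ /=; rewrite count_partial_mset count_copies !inE.
rewrite andbT; have [->|_] := eqVneq z 1; first by rewrite (negPf A1).
by rewrite if_same.
Qed.

End Multiplicities.

Theorem theorem2p10 (gT : finGroupType) (n m k lambda mu : nat)
    (D : 'I_m -> {set gT})
    (hn : #|[set: gT]| = n)
    (hD : disjoint_ksubsets k D)
    (hpds : forall i, is_partial_difference_set n k lambda mu (D i)) :
  let S := \bigcup_(i < m) D i in
  [/\ is_DPDF n k (lambda + (m - 1) * mu)%N (m * mu)%N D,
      forall sigma chi : nat,
        is_partial_difference_set n (m * k)%N sigma chi S ->
        is_EPDF n k (sigma - (lambda + (m - 1) * mu))%N (chi - m * mu)%N D
    & forall sigma : nat,
        1 \notin S ->
        is_difference_set n (m * k)%N sigma S ->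
        is_EPDF n k (sigma - (lambda + (m - 1) * mu))%N (sigma - m * mu)%N D].
Proof.
move=> S; split=> [|sigma chi [_ _ pS]|sigma S1 [_ _ pS]].
- split=> //; apply/allP => z _ /=; apply/eqP.
  exact: (count_internal hD hpds).
- exact: (family_EPDF hD hpds).
- apply: (family_EPDF hD hpds) => //.
  exact: perm_trans pS (copies_partial_mset _ S1).
Qed.
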